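(* Let $\mathrm{mCoarse}$ denote the category of metric spaces and coarse maps modulo closeness, and $\mathrm{Top}$ the category of topological spaces and continuous maps. The functor $\nu':\mathrm{mCoarse}\to\mathrm{Top}$, $X\mapsto\nu'(X)$, $f\mapsto\nu'(f)$, reflects isomorphisms.
   Context: Metrics take finite values. A subset $E\subseteq X\times X$ of a metric space $(X,d)$ is an entourage if $\sup_{(x,y)\in E}d(x,y)<\infty$. For $A\subseteq X$ write $E[A]=\{x\in X:(x,a)\in E\text{ for some }a\in A\}$. A map $f:X\to Y$ between metric spaces is coarse if $(f\times f)(E)$ is an entourage of $Y$ for every entourage $E$ of $X$, and $f^{-1}(B)$ is bounded for every bounded $B\subseteq Y$. Two maps $f,g:X\to Y$ are close if $\{(f(x),g(x)):x\in X\}$ is an entourage of $Y$. For $A,B\subseteq X$ write $A\curlywedge B$ if there is an entourage $E$ of $X$ such that $E[A]\cap E[B]$ is not bounded. A coarse ultrafilter on $X$ is a system $\mathcal F$ of subsets of $X$ such that: (1) $A,B\in\mathcal F$ implies $A\curlywedge B$; (2) if $A,B\subseteq X$ and $A\cup B\in\mathcal F$ then $A\in\mathcal F$ or $B\in\mathcal F$; (3) $X\in\mathcal F$. Two coarse ultrafilters $\mathcal F,\mathcal G$ on $X$ are asymptotically alike, $\mathcal F\lambda\mathcal G$, if $A\curlywedge B$ for all $A\in\mathcal F$, $B\in\mathcal G$; this is an equivalence relation. The corona $\nu'(X)$ is the set of coarse ultrafilters on $X$ modulo $\lambda$, with the topology generated by the complements of the sets $\mathrm{cl}(A)=\{[\mathcal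 F]\in\nu'(X):A\in\mathcal F\}$, $A\subseteq X$. For a coarse map $f:X\to Y$, $\nu'(f):\nu'(X)\to\nu'(Y)$ is the continuous map $[\mathcal F]\mapsto[f_*\mathcal F]$, where $f_*\mathcal F=\{A\subseteq Y:f^{-1}(A)\in\mathcal F\}$.
   Formalization: Metric spaces are assumed nonempty: with the empty space allowed the claim fails, since the map from the empty space to a one-point space is coarse and induces a homeomorphism of empty coronas but has no inverse. *)

(* Defs.v *)
From HB Require Import structures.
From mathcomp Require Import all_boot all_order all_algebra.
From mathcomp Require Import all_classical all_reals topology.
From mathcomp Require Import finmap lra.

Set Implicit Arguments.
Unset Strict Implicit.
Unset Printing Implicit Defensive.

Import Order.TTheory GRing.Theory Num.Theory.

Local Open Scope classical_set_scope.
Local Open Scope ring_scope.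
Local Open Scope quotient_scope.

Record category := Category {
  obj :> Type;
  hom : obj -> obj -> Type;
  idm : forall a, hom a a;
  compm : forall a b c, hom b c -> hom a b -> hom a c;
  compmA : forall a b c d (h : hom c d) (g : hom b c) (f : hom a b),
    compm h (compm g f) = compm (compm h g) f;
  compidm : forall a b (f : hom a b), compm (idm b) f = f;
  compmid : forall a b (f : hom a b), compm f (idm a) = f
}.
Arguments idm {_} a.
Arguments compm {_ _ _ _} g f.

Definition is_iso (C : category) (a b : C) (f : hom a b) : Prop :=
  exists g : hom b a, compm g f = idm a /\ compm f g = idm b.

Record functor (C D : category) := Functor {
  fobj :> C -> D;
  fmap : forall a b : C, hom a b -> hom (fobj a) (fobj b);
  fmap_id : forall a : C, fmap (idm a) = idm (fobj a);
  fmap_comp : forall (a b c : C) (g : hom b c) (f : hom a b),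
    fmap (compm g f) = compm (fmap g) (fmap f)
}.
Arguments fmap {_ _} _ {_ _} f.

Definition reflects_isomorphisms (C D : category) (F : functor C D) : Prop :=
  forall (a b : C) (f : hom a b), is_iso (fmap F f) -> is_iso f.

(* [entourage] and [close] already denote uniform and topological notions in
   the library, hence the names [coarse_entourage] and [coarse_close]. *)
Section coarse.
Context {R : realType}.

(* An upper bound rather than a finite [sup], so that the empty relation is an
   entourage and the empty set is bounded. *)
Definition coarse_entourage (X : metricType R) (E : set (X * X)) : Prop :=
  has_ubound [set mdist p.1 p.2 | p in E].

Definition mbounded (X : metricType R) (B : set X) : Prop :=
  coarse_entourage (B `*` B).

Definition thicken (X : metricType R) (E : set (X * X)) (A : set X) : set X :=
  [set x | exists2 a, A a & E (x, a)].

Definition coarse (X Y : metricType R) (f : X -> Y) : Prop :=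
  (forall E, coarse_entourage E ->
     coarse_entourage [set (f p.1, f p.2) | p in E]) /\
  (forall B, mbounded B -> mbounded (f @^-1` B)).

Definition coarse_close (X Y : metricType R) (f g : X -> Y) : Prop :=
  coarse_entourage (range (fun x => (f x, g x))).

Definition cwedge (X : metricType R) (A B : set X) : Prop :=
  exists2 E : set (X * X), coarse_entourage E &
    ~ mbounded (thicken E A `&` thicken E B).

Record coarse_ultrafilter (X : metricType R) := CoarseUltrafilter {
  ultra_sets :> set X -> Prop;
  ultra_wedge : forall A B, ultra_sets A -> ultra_sets B -> cwedge A B;
  ultra_split : forall A B, ultra_sets (A `|` B) -> ultra_sets A \/ ultra_sets B;
  ultra_setT : ultra_sets setT
}.

Definition alike (X : metricType R) (F G : coarse_ultrafilter X) : Prop :=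
  forall A B, F A -> G B -> cwedge A B.

End coarse.

Section theory.
Context {R : realType}.
Implicit Types X Y Z : metricType R.

Lemma coarse_entourageP X (E : set (X * X)) :
  coarse_entourage E <-> exists M, forall x y, E (x, y) -> mdist x y <= M.
Proof.
split=> -[M hM]; exists M.
  by move=> x y Exy; apply: hM; exists (x, y).
by move=> _ [[x y] Exy <-]; exact: hM.
Qed.

Lemma mboundedP X (B : set X) :
  mbounded B <-> forall x0, exists M, forall x, B x -> mdist x0 x <= M.
Proof.
split.
  move/coarse_entourageP => [M hM] x0.
  have [[b Bb]|nB] := pselect (exists b, B b); last first.
    by exists 0 => x Bx; case: nB; exists x.
  exists (mdist x0 b + M) => x Bx.
  by rewrite (le_trans (metric_triangle x0 b x))// lerD2l hM.
move=> h; apply/coarse_entourageP.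
have [[b Bb]|nB] := pselect (exists b, B b); last first.
  by exists 0 => x y [Bx _]; case: nB; exists x.
have [M hM] := h b; exists (M + M) => x y [/= Bx By].
rewrite (le_trans (metric_triangle x b y))// lerD ?hM//.
by rewrite metric_sym hM.
Qed.

Lemma mboundedS X (A B : set X) : A `<=` B -> mbounded B -> mbounded A.
Proof.
move=> AB /mboundedP bB; apply/mboundedP => x0.
by have [M hM] := bB x0; exists M => x /AB /hM.
Qed.

Lemma mboundedU X (A B : set X) :
  mbounded A -> mbounded B -> mbounded (A `|` B).
Proof.
move=> /mboundedP bA /mboundedP bB; apply/mboundedP => x0.
have [M hM] := bA x0; have [N hN] := bB x0; exists (Num.max M N) => x.
by rewrite le_max => -[/hM ->//|/hN ->]; rewrite orbT.
Qed.

Definition tube X (r : R) (A : set X) : set X :=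
  [set x | exists2 a, A a & mdist x a <= r].

Lemma tubeS X r s (A B : set X) : r <= s -> A `<=` B -> tube r A `<=` tube s B.
Proof.
by move=> rs AB x [a Aa xa]; exists a; [exact: AB|exact: le_trans rs].
Qed.

Lemma cwedgeP X (A B : set X) :
  cwedge A B <-> exists r, ~ mbounded (tube r A `&` tube r B).
Proof.
split=> [[E /coarse_entourageP[r hr] nb]|[r nb]].
  exists r => b; apply: nb; apply: mboundedS b => x [[a Aa xa] [b Bb xb]].
  by split; [exists a|exists b] => //; exact: hr.
exists [set p | mdist p.1 p.2 <= r] => //.
by apply/coarse_entourageP; exists r.
Qed.

Lemma cwedgeN X (A B : set X) :
  ~ cwedge A B <-> forall r, mbounded (tube r A `&` tube r B).
Proof.
split=> [nAB r|h /cwedgeP[r]]; last exact.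
by apply: contrapT => nb; apply: nAB; apply/cwedgeP; exists r.
Qed.

Lemma cwedge_sym X (A B : set X) : cwedge A B -> cwedge B A.
Proof. by move=> [E EE nb]; exists E; rewrite // setIC. Qed.

Lemma cwedgeS X (A B A' B' : set X) :
  A `<=` A' -> B `<=` B' -> cwedge A B -> cwedge A' B'.
Proof.
move=> AA BB /cwedgeP[r nb]; apply/cwedgeP; exists r => b; apply: nb.
by apply: mboundedS b; apply: setISS; exact: tubeS.
Qed.

Lemma cwedgeU X (A B C : set X) :
  cwedge (A `|` B) C -> cwedge A C \/ cwedge B C.
Proof.
move=> /cwedgeP[r nb]; apply: contrapT => /not_orP[/cwedgeN nA /cwedgeN nB].
apply: nb; apply: mboundedS (mboundedU (nA r) (nB r)).
by move=> x [[a [Aa|Ba] xa] xC]; [left|right]; split => //; exists a.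
Qed.

Lemma cwedge_sep X (A B : set X) : ~ cwedge A B ->
  exists D, ~ cwedge A D /\ ~ cwedge (~` D) B.
Proof.
move=> /cwedgeN nAB.
exists [set x | forall a, A a -> exists2 b, B b & mdist x b <= mdist x a + 1].
split; apply/cwedgeN => r; apply: mboundedS (nAB (3 * r + 1)).
  move=> z [[a Aa za] [x /= + zx]] => /(_ a Aa)[b Bb xb].
  have := mdist_ge0 z a; have := metric_triangle z x b.
  have := metric_triangle x z a; rewrite (metric_sym x z) => h1 h2 h3.
  by split; [exists a|exists b] => //; lra.
move=> z [[x /= + zx] [b Bb zb]].
move=> /existsNP[a /not_implyP[Aa nb]].
have {}nb : mdist x a + 1 < mdist x b.
  by rewrite ltNge; apply/negP => h; apply: nb; exists b.
have := mdist_ge0 z x; have := metric_triangle z x a.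
have := metric_triangle x z b; rewrite (metric_sym x z) => h1 h2 h3.
by split; [exists a|exists b] => //; lra.
Qed.

Lemma coarse_id X : coarse (@idfun X).
Proof.
split=> // E; rewrite (_ : [set _ | _ in E] = E)//.
by apply/seteqP; split=> [_ [[x y] Exy <-]//|[x y] Exy]; exists (x, y).
Qed.

Lemma coarse_comp X Y Z (g : Y -> Z) (f : X -> Y) :
  coarse g -> coarse f -> coarse (g \o f).
Proof.
move=> [ge gb] [fe fb]; split=> [E /fe/ge|B /gb/fb//].
by rewrite image_comp.
Qed.

Lemma coarse_closeP X Y (f g : X -> Y) :
  coarse_close f g <-> exists M, forall x, mdist (f x) (g x) <= M.
Proof.
split=> [/coarse_entourageP|] [M hM].
  by exists M => x; apply: hM; exists x.
by apply/coarse_entourageP; exists M => _ _ [x _ [<- <-]].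
Qed.

Lemma coarse_modulus X Y (f : X -> Y) : coarse f ->
  forall r, exists M, forall x y, mdist x y <= r -> mdist (f x) (f y) <= M.
Proof.
move=> [fe _] r.
have /fe/coarse_entourageP[M hM] :
    coarse_entourage [set p : X * X | mdist p.1 p.2 <= r].
  by apply/coarse_entourageP; exists r.
by exists M => x y xy; apply: hM; exists (x, y).
Qed.

Lemma coarse_close_refl X Y (f : X -> Y) : coarse_close f f.
Proof. by apply/coarse_closeP; exists 0 => x; rewrite mdistxx. Qed.

Lemma coarse_close_sym X Y (f g : X -> Y) :
  coarse_close f g -> coarse_close g f.
Proof.
move=> /coarse_closeP[M hM]; apply/coarse_closeP; exists M => x.
by rewrite metric_sym.
Qed.

Lemma coarse_close_trans X Y (g f h : X -> Y) :
  coarse_close f g -> coarse_close g h -> coarse_close f h.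
Proof.
move=> /coarse_closeP[M hM] /coarse_closeP[N hN]; apply/coarse_closeP.
exists (M + N) => x.
by rewrite (le_trans (metric_triangle _ (g x) _))// lerD.
Qed.

Lemma coarse_close_comp X Y Z (g g' : Y -> Z) (f f' : X -> Y) :
  coarse g -> coarse_close g g' -> coarse_close f f' ->
  coarse_close (g \o f) (g' \o f').
Proof.
move=> cg /coarse_closeP[M hM] /coarse_closeP[N hN].
have [K hK] := coarse_modulus cg N.
apply/coarse_closeP; exists (K + M) => x /=.
by rewrite (le_trans (metric_triangle _ (g (f' x)) _))// lerD// hK.
Qed.

Lemma cwedge_preimage X Y (f g : X -> Y) (A B : set Y) :
  coarse f -> coarse_close f g ->
  cwedge (f @^-1` A) (g @^-1` B) -> cwedge A B.
Proof.
move=> cf /coarse_closeP[N hN] /cwedgeP[r nb]; apply: contrapT => /cwedgeN nAB.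
have [M hM] := coarse_modulus cf r.
apply: nb; apply: mboundedS (cf.2 _ (nAB (M + N))) => z [[a Aa za] [b Bb zb]].
have ha := hM _ _ za; have hb := hM _ _ zb.
have := hN b; have := metric_triangle (f z) (f b) (g b).
have := mdist_ge0 (f b) (g b) => h1 h2 h3.
by split; [exists (f a)|exists (g b)] => //; lra.
Qed.

Lemma alike_refl X (F : coarse_ultrafilter X) : alike F F.
Proof. by move=> A B FA FB; exact: ultra_wedge FA FB. Qed.

Lemma alike_sym X (F G : coarse_ultrafilter X) : alike F G -> alike G F.
Proof. by move=> FG A B GA FB; apply: cwedge_sym; exact: FG. Qed.

Lemma ultra_setC X (F : coarse_ultrafilter X) (A : set X) : F A \/ F (~` A).
Proof. by apply: ultra_split; rewrite setUv; exact: ultra_setT. Qed.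

Lemma alike_trans X (G F H : coarse_ultrafilter X) :
  alike F G -> alike G H -> alike F H.
Proof.
move=> FG GH A C FA HC; apply: contrapT => /cwedge_sep[D [nAD nDC]].
have [GD|GD] := ultra_setC G D; first exact: nAD (FG _ _ FA GD).
exact: nDC (GH _ _ GD HC).
Qed.

Section pushforward.
Context {X Y : metricType R} (f : X -> Y) (cf : coarse f).
Variable F : coarse_ultrafilter X.

Let push_sets : set (set Y) := [set A | F (f @^-1` A)].

Let push_wedge A B : push_sets A -> push_sets B -> cwedge A B.
Proof.
move=> FA FB; apply: (cwedge_preimage cf (coarse_close_refl f)).
exact: ultra_wedge FA FB.
Qed.

Let push_split A B : push_sets (A `|` B) -> push_sets A \/ push_sets B.
Proof. by rewrite /push_sets/= preimage_setU => /ultra_split. Qed.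

Definition pushforward : coarse_ultrafilter Y :=
  @CoarseUltrafilter R Y push_sets push_wedge push_split (ultra_setT F).

End pushforward.

Lemma alike_pushforward X Y (f g : X -> Y) (cf : coarse f) (cg : coarse g)
    (F G : coarse_ultrafilter X) :
  coarse_close f g -> alike F G -> alike (pushforward cf F) (pushforward cg G).
Proof.
move=> fg FG A B FA GB; apply: (cwedge_preimage cf fg).
exact: FG FA GB.
Qed.

(* [saturation F] is the largest coarse ultrafilter asymptotically alike [F]. *)
Section saturation.
Context {X : metricType R} (F : coarse_ultrafilter X).

Let sat_sets : set (set X) := [set C | forall A, F A -> cwedge A C].

Let sat_wedge A B : sat_sets A -> sat_sets B -> cwedge A B.
Proof.
move=> sA sB; apply: contrapT => /cwedge_sep[D [nAD nDB]].
have [FD|FD] := ultra_setC F D; first exact: nAD (cwedge_sym (sA _ FD)).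
exact: nDB (sB _ FD).
Qed.

Let sat_split A B : sat_sets (A `|` B) -> sat_sets A \/ sat_sets B.
Proof.
move=> sAB; apply: contrapT => /not_orP[nA nB].
have sep C : ~ sat_sets C -> exists D, ~ cwedge C D /\ ~ F (~` D).
  move=> /existsNP[C' /not_implyP[FC' nC]].
  have /cwedge_sep[D [nCD nDC']] : ~ cwedge C C' by move=> /cwedge_sym.
  by exists D; split=> // FD; exact: nDC' (ultra_wedge FD FC').
have [D [nAD nFD]] := sep _ nA; have [D' [nBD nFD']] := sep _ nB.
have : F (D `&` D').
  have [//|] := ultra_setC F (D `&` D').
  by rewrite setCI => /ultra_split[].
move=> /sAB /cwedge_sym /cwedgeU[] w; [apply: nAD|apply: nBD];
  by apply: cwedgeS w => // x [].
Qed.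

Let sat_setT : sat_sets setT.
Proof. by move=> A FA; exact: ultra_wedge FA (ultra_setT F). Qed.

Definition saturation : coarse_ultrafilter X :=
  @CoarseUltrafilter R X sat_sets sat_wedge sat_split sat_setT.

Lemma alike_saturation : alike F saturation.
Proof. by move=> A B FA; apply. Qed.

End saturation.

End theory.

Section corona.
Context {R : realType} (X : metricType R).

HB.instance Definition _ := gen_eqMixin (coarse_ultrafilter X).
HB.instance Definition _ := gen_choiceMixin (coarse_ultrafilter X).

Definition alikeb : rel (coarse_ultrafilter X) := fun F G => `[< alike F G >].

Lemma alikeb_refl : reflexive alikeb.
Proof. by move=> F; apply/asboolP; exact: alike_refl. Qed.

Lemma alikeb_sym : symmetric alikeb.
Proof. by move=> F G; apply/asboolP/asboolP; exact: alike_sym. Qed.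

Lemma alikeb_trans : transitive alikeb.
Proof.
by move=> G F H /asboolP FG /asboolP GH; apply/asboolP; exact: alike_trans GH.
Qed.

Canonical alike_equiv := EquivRel alikeb alikeb_refl alikeb_sym alikeb_trans.

Definition corona : Type := {eq_quot alike_equiv}.

HB.instance Definition _ := Quotient.copy corona {eq_quot alike_equiv}.
HB.instance Definition _ := gen_eqMixin corona.
HB.instance Definition _ := gen_choiceMixin corona.

Definition corona_class (F : coarse_ultrafilter X) : corona := \pi_corona F.

(* The condition [F A] depends on the representative [F], not only on its class:
   a class lies in [corona_cl A] as soon as one of its members contains [A]. *)
Definition corona_cl (A : set X) : set corona :=
  [set corona_class F | F in [set F : coarse_ultrafilter X | F A]].

HB.instance Definition _ :=
  isSubBaseTopological.Build corona setT (fun A : set X => ~` corona_cl A).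

End corona.

Section corona_map.
Context {R : realType}.
Implicit Types X Y Z : metricType R.

Lemma corona_classE X (F G : coarse_ultrafilter X) :
  corona_class F = corona_class G <-> alike F G.
Proof.
split=> [FG|FG]; first by apply/asboolP; exact/(@eqmodP _ (alike_equiv X)).
by apply/(@eqmodP _ (alike_equiv X))/asboolP.
Qed.

Lemma corona_classK X (c : corona X) : corona_class (repr c) = c.
Proof. exact: reprK. Qed.

Lemma corona_clE X (F : coarse_ultrafilter X) (B : set X) :
  corona_cl B (corona_class F) <-> forall A, F A -> cwedge A B.
Proof.
split=> [[G GB /corona_classE GF] A FA|h].
  by apply: cwedge_sym; exact: GF.
exists (saturation F); first exact: h.
by apply/corona_classE/alike_sym/alike_saturation.
Qed.

Lemma closed_corona_cl X (A : set X) : closed (corona_cl A).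
Proof.
rewrite -openC; exists [set ~` corona_cl A]; last by rewrite bigcup_set1.
move=> _ ->; exists [fset A]%fset; first by move=> ? _; exact: mem_set.
by rewrite set_fset1 bigcap_set1.
Qed.

Lemma continuous_corona (T : topologicalType) X (h : T -> corona X) :
  (forall A, closed (h @^-1` corona_cl A)) -> continuous h.
Proof.
move=> hcl; apply/continuousP => _ [D sD <-].
rewrite preimage_bigcup; apply: bigcup_open => U /sD[I _ <-].
rewrite preimage_bigcap bigcap_fset.
elim/big_rec: _ => [|A V _ oV]; first exact: openT.
by apply: openI => //; have := hcl A; rewrite -openC.
Qed.

Definition corona_map X Y (f : X -> Y) (cf : coarse f) (c : corona X) :
  corona Y := corona_class (pushforward cf (repr c)).

Lemma corona_mapE X Y (f : X -> Y) (cf : coarse f) (F : coarse_ultrafilter X) :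
  corona_map cf (corona_class F) = corona_class (pushforward cf F).
Proof.
apply/corona_classE/alike_pushforward; first exact: coarse_close_refl.
by apply/corona_classE; rewrite corona_classK.
Qed.

Lemma corona_map_continuous X Y (f : X -> Y) (cf : coarse f) :
  continuous (corona_map cf).
Proof.
apply: continuous_corona => B; rewrite -openC openE => c /= ncB.
rewrite -(corona_classK c) in ncB *; set F := repr c in ncB *.
move: ncB; rewrite corona_mapE => /(corona_clE _ _).
move=> /existsNP[A /not_implyP[FA /cwedge_sep[D [nAD nDB]]]].
rewrite /interior nbhsE; exists (~` corona_cl (f @^-1` D)).
  split; first by rewrite openC; exact: closed_corona_cl.
  move=> /corona_clE/(_ _ FA) w; apply: nAD.
  exact: cwedge_preimage cf (coarse_close_refl f) w.
move=> e; rewrite -(corona_classK e); set G := repr e => nG.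
rewrite /= corona_mapE => /corona_clE h; apply: nDB; apply: h.
have [GD|//] := ultra_setC G (f @^-1` D).
by case: nG; exists G.
Qed.

Lemma corona_map_close X Y (f g : X -> Y) (cf : coarse f) (cg : coarse g) :
  coarse_close f g -> corona_map cf =1 corona_map cg.
Proof.
move=> fg c; apply/corona_classE.
apply: alike_pushforward => //.
exact: alike_refl.
Qed.

Lemma corona_map_id X (cf : coarse (@idfun X)) : corona_map cf =1 id.
Proof.
move=> c; rewrite -[RHS]corona_classK; apply/corona_classE.
by move=> A B FA FB; exact: ultra_wedge FA FB.
Qed.

Lemma corona_map_comp X Y Z (g : Y -> Z) (f : X -> Y)
    (cg : coarse g) (cf : coarse f) (cgf : coarse (g \o f)) :
  corona_map cgf =1 corona_map cg \o corona_map cf.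
Proof.
move=> c; rewrite -(corona_classK c) /= !corona_mapE; apply/corona_classE.
by move=> A B FA FB; exact: ultra_wedge FA FB.
Qed.

End corona_map.
Arguments corona_map_continuous {R X Y f} cf.

Section mCoarse.
Context {R : realType}.

Record coarse_map (X Y : metricType R) := CoarseMap {
  coarse_fun :> X -> Y;
  coarse_funP : coarse coarse_fun
}.

Section coarse_mor.
Context (X Y : metricType R).

HB.instance Definition _ := gen_eqMixin (coarse_map X Y).
HB.instance Definition _ := gen_choiceMixin (coarse_map X Y).

Definition coarse_closeb : rel (coarse_map X Y) :=
  fun f g => `[< coarse_close f g >].

Lemma coarse_closeb_refl : reflexive coarse_closeb.
Proof. by move=> f; apply/asboolP; exact: coarse_close_refl. Qed.

Lemma coarse_closeb_sym : symmetric coarse_closeb.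
Proof. by move=> f g; apply/asboolP/asboolP; exact: coarse_close_sym. Qed.

Lemma coarse_closeb_trans : transitive coarse_closeb.
Proof.
move=> g f h /asboolP fg /asboolP gh; apply/asboolP.
exact: coarse_close_trans gh.
Qed.

Canonical coarse_close_equiv := EquivRel coarse_closeb
  coarse_closeb_refl coarse_closeb_sym coarse_closeb_trans.

Definition coarse_mor : Type := {eq_quot coarse_close_equiv}.

HB.instance Definition _ := Quotient.copy coarse_mor {eq_quot coarse_close_equiv}.

Definition coarse_class (f : coarse_map X Y) : coarse_mor := \pi_coarse_mor f.

Lemma coarse_classE (f g : coarse_map X Y) :
  coarse_class f = coarse_class g <-> coarse_close f g.
Proof.
split=> [fg|fg]; first by apply/asboolP; exact/(@eqmodP _ coarse_close_equiv).
by apply/(@eqmodP _ coarse_close_equiv)/asboolP.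
Qed.

Lemma coarse_classK (u : coarse_mor) : coarse_class (repr u) = u.
Proof. exact: reprK. Qed.

End coarse_mor.

Definition coarse_map_id (X : metricType R) : coarse_map X X :=
  CoarseMap (coarse_id X).

Definition coarse_map_comp (X Y Z : metricType R)
    (g : coarse_map Y Z) (f : coarse_map X Y) : coarse_map X Z :=
  CoarseMap (coarse_comp (coarse_funP g) (coarse_funP f)).

Definition coarse_mor_comp (X Y Z : metricType R)
    (v : coarse_mor Y Z) (u : coarse_mor X Y) : coarse_mor X Z :=
  coarse_class (coarse_map_comp (repr v) (repr u)).

Lemma coarse_mor_compE (X Y Z : metricType R)
    (g : coarse_map Y Z) (f : coarse_map X Y) :
  coarse_mor_comp (coarse_class g) (coarse_class f) =
  coarse_class (coarse_map_comp g f).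
Proof.
apply/coarse_classE; apply: coarse_close_comp; first exact: coarse_funP.
  by apply/coarse_classE; rewrite coarse_classK.
by apply/coarse_classE; rewrite coarse_classK.
Qed.

Lemma coarse_mor_compA (X Y Z T : metricType R) (w : coarse_mor Z T)
    (v : coarse_mor Y Z) (u : coarse_mor X Y) :
  coarse_mor_comp w (coarse_mor_comp v u) =
  coarse_mor_comp (coarse_mor_comp w v) u.
Proof.
rewrite -(coarse_classK u) -(coarse_classK v) -(coarse_classK w).
by rewrite !coarse_mor_compE; apply/coarse_classE; exact: coarse_close_refl.
Qed.

Lemma coarse_mor_comp1m (X Y : metricType R) (u : coarse_mor X Y) :
  coarse_mor_comp (coarse_class (coarse_map_id Y)) u = u.
Proof.
rewrite -(coarse_classK u) coarse_mor_compE.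
by apply/coarse_classE; exact: coarse_close_refl.
Qed.

Lemma coarse_mor_compm1 (X Y : metricType R) (u : coarse_mor X Y) :
  coarse_mor_comp u (coarse_class (coarse_map_id X)) = u.
Proof.
rewrite -(coarse_classK u) coarse_mor_compE.
by apply/coarse_classE; exact: coarse_close_refl.
Qed.

Definition corona_fmap (X Y : metricType R) (u : coarse_mor X Y) :
    continuousType (corona X) (corona Y) :=
  mkcts (corona_map_continuous (coarse_funP (repr u))).

Lemma corona_fmapE (X Y : metricType R) (f : coarse_map X Y) :
  corona_fmap (coarse_class f) =1 corona_map (coarse_funP f).
Proof.
by apply: corona_map_close; apply/coarse_classE; rewrite coarse_classK.
Qed.

(* Metric spaces are nonempty: the unique map from the empty space to a
   one-point space is coarse and induces the identity of the empty corona,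
   but it has no inverse. *)
Record nemetric := NEMetric {
  nemetric_sort :> metricType R;
  nemetric_nonempty : [set: nemetric_sort] !=set0
}.

Definition mCoarse : category :=
  @Category nemetric (fun X Y => coarse_mor X Y)
    (fun X => coarse_class (coarse_map_id X))
    (fun X Y Z v u => coarse_mor_comp v u)
    (fun X Y Z T w v u => coarse_mor_compA w v u)
    (fun X Y u => coarse_mor_comp1m u)
    (fun X Y u => coarse_mor_compm1 u).

End mCoarse.
Arguments nemetric : clear implicits.
Arguments mCoarse : clear implicits.

Lemma cts_compA (X Y Z T : topologicalType) (h : continuousType Z T)
    (g : continuousType Y Z) (f : continuousType X Y) :
  h \o (g \o f) = (h \o g) \o f :> continuousType X T.
Proof. exact/continuousEP. Qed.

Lemma cts_comp1f (X Y : topologicalType) (f : continuousType X Y) :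
  idfun \o f = f :> continuousType X Y.
Proof. exact/continuousEP. Qed.

Lemma cts_compf1 (X Y : topologicalType) (f : continuousType X Y) :
  f \o idfun = f :> continuousType X Y.
Proof. exact/continuousEP. Qed.

Definition Top : category :=
  @Category topologicalType (fun X Y => continuousType X Y)
    (fun X => idfun : continuousType X X)
    (fun X Y Z g f => g \o f : continuousType X Z)
    cts_compA cts_comp1f cts_compf1.

Section nu.
Context (R : realType).

Lemma corona_fmap_id (X : mCoarse R) :
  corona_fmap (idm X) = idfun :> continuousType (corona X) (corona X).
Proof.
by apply/continuousEP => c; rewrite corona_fmapE corona_map_id.
Qed.

Lemma corona_fmap_comp (X Y Z : mCoarse R) (v : hom Y Z) (u : hom X Y) :
  corona_fmap (compm v u) = corona_fmap v \o corona_fmap u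
    :> continuousType (corona X) (corona Z).
Proof.
apply/continuousEP => c.
by rewrite corona_fmapE (corona_map_comp (coarse_funP _) (coarse_funP _)).
Qed.

Definition nu : functor (mCoarse R) Top :=
  @Functor (mCoarse R) Top (fun X : nemetric R => corona X : topologicalType)
    (fun X Y u => corona_fmap u) corona_fmap_id corona_fmap_comp.

End nu.

(* Main.v *)
Require Import Defs.
From mathcomp Require Import all_boot all_order all_algebra.
From mathcomp Require Import all_classical all_reals topology.
From mathcomp Require Import lra.

(** Bijectivity of [nu f] already suffices. If [f] is not coarsely surjective,
    there are points [y n] at distance more than [n] from the image; an
    ultrafilter carried by this sequence contains a set which is not [cwedge]
    to the image, so its class is not in the image of [nu f]. If [f] is not a
    coarse embedding, there are [x n], [y n] with [f (x n)] and [f (y n)]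
    uniformly close and [x n], [y n] far apart; for a sparse choice the ranges
    of [x] and [y] are not [cwedge], while pushing one free ultrafilter on [nat]
    along [x] and along [y] gives two coarse ultrafilters whose images under
    [f] are alike. A coarsely surjective coarse embedding has a coarse inverse. *)

Set Implicit Arguments.
Unset Strict Implicit.
Unset Printing Implicit Defensive.

Import Order.TTheory GRing.Theory Num.Theory.

Local Open Scope classical_set_scope.
Local Open Scope ring_scope.

Section divergent_sequences.
Context {R : realType}.
Implicit Types X Y : metricType R.

Definition divergent X (p : nat -> X) : Prop :=
  forall B, mbounded B -> \forall n \near \oo, ~ B (p n).

Lemma divergent_dist X (x0 : X) (p : nat -> X) :
  (forall n, n%:R < mdist x0 (p n)) -> divergent p.
Proof.
move=> hp B /mboundedP/(_ x0)[M hM].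
near=> n => /hM; apply/negP; rewrite -ltNge (le_lt_trans _ (hp n))//.
by near: n; exact: nbhs_infty_ger.
Unshelve. all: by end_near. Qed.

Lemma divergent_comp X Y (f : X -> Y) (p : nat -> X) :
  coarse f -> divergent p -> divergent (f \o p).
Proof. by move=> [_ fb] dp B /fb/dp. Qed.

Lemma mbounded_tube_initial X (p : nat -> X) (r : R) (N : nat) :
  mbounded (tube r [set p n | n in [set n | (n < N)%N]]).
Proof.
(* The sum over the initial segment is a crude bound for the maximum of its distances to [x0]. *)
apply/mboundedP => x0; exists (\sum_(i < N) mdist x0 (p i) + r).
move=> x [_ [n nN <-] xr]; rewrite (le_trans (metric_triangle _ (p n) _))//.
rewrite lerD//; last by rewrite metric_sym.
rewrite (bigD1 (Ordinal nN))//= lerDl sumr_ge0// => i _.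
exact: mdist_ge0.
Qed.

(** A point within [r] of both [p n] and some [a] in [A] forces [mdist (p n) a <= r + r], so only an
    initial segment of [p] contributes to the intersection of the [r]-tubes. *)
Lemma cwedgeN_range X (p : nat -> X) (A : set X) :
  (forall r, \forall n \near \oo, forall a, A a -> r < mdist (p n) a) ->
  ~ cwedge (range p) A.
Proof.
move=> hp; apply/cwedgeN => r; have [N _ hN] := hp (r + r).
apply: mboundedS (@mbounded_tube_initial _ p r N).
move=> z [[_ [n _ <-] zn] [a Aa za]]; exists (p n) => //; exists n => //=.
rewrite ltnNge; apply/negP => Nn; have := hN n Nn a Aa.
apply/negP; rewrite -leNgt (le_trans (metric_triangle _ z _))// lerD//.
by rewrite metric_sym.
Qed.

Section sequence_ultrafilter.
Context {X : metricType R} (U : set_system nat) {UU : UltraFilter U}.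
Hypothesis Uoo : \oo `<=` U.
Variables (p : nat -> X) (dp : divergent p).

Let seq_sets : set (set X) := [set A | U (p @^-1` A)].

(** Radius 0 suffices: [p n] lies in both sets for [U]-many [n], yet would eventually leave their
    intersection if it were bounded. *)
Let seq_wedge A B : seq_sets A -> seq_sets B -> cwedge A B.
Proof.
rewrite /seq_sets/= => UA UB; apply/cwedgeP; exists 0 => b.
have [n [[An Bn]]] := filter_ex (filterI (filterI UA UB) (Uoo (dp b))).
by apply; split; exists (p n); rewrite ?mdistxx.
Qed.

Let seq_split A B : seq_sets (A `|` B) -> seq_sets A \/ seq_sets B.
Proof.
rewrite /seq_sets/= => UAB; have [|UnA] := in_ultra_setVsetC (p @^-1` A) UU; first by left.
right; apply: filterS (filterI UAB UnA).
by move=> n [[|]].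
Qed.

Let seq_setT : seq_sets setT.
Proof. exact: filterT. Qed.

Definition seq_ultrafilter : coarse_ultrafilter X :=
  @CoarseUltrafilter R X seq_sets seq_wedge seq_split seq_setT.

Lemma seq_ultrafilter_range : seq_ultrafilter (range p).
Proof. by apply: (@filterS _ U _ setT _ _ filterT) => n _; exists n. Qed.

End sequence_ultrafilter.

(** For [U]-many [n], [f (p n)] is in [A] and [f (q n)] in [B], so [f (p n)] lies in both [r]-tubes;
    being divergent, [f \o p] makes their intersection unbounded. *)
Lemma alike_push_seq X Y (f : X -> Y) (cf : coarse f)
    (U : set_system nat) (UU : UltraFilter U) (Uoo : \oo `<=` U)
    (p q : nat -> X) (dp : divergent p) (dq : divergent q) (r : R) :
  (forall n, mdist (f (p n)) (f (q n)) <= r) ->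
  alike (pushforward cf (seq_ultrafilter Uoo dp))
        (pushforward cf (seq_ultrafilter Uoo dq)).
Proof.
move=> hr A B /= UA UB; apply/cwedgeP; exists r => b.
have [n [[An Bn]]] := filter_ex
  (filterI (filterI UA UB) (Uoo _ (divergent_comp cf dp b))).
apply; split; last by exists (f (q n)); last exact: hr.
by exists (f (p n)); rewrite // mdistxx (le_trans (mdist_ge0 _ _) (hr n)).
Qed.

Lemma sparse_pairs X (x0 : X) (P : X -> X -> Prop) :
  (forall K, exists x y,
     [/\ P x y, K < mdist x y, K < mdist x0 x & K < mdist x0 y]) ->
  exists x y : nat -> X,
    [/\ forall n, P (x n) (y n), forall n, n%:R < mdist x0 (x n),
        forall n, n%:R < mdist x0 (y n) &
        forall m n, m%:R < mdist (x m) (y n)].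
Proof.
move=> hP; have /choice[p hp] : forall K, exists xy : X * X,
    [/\ P xy.1 xy.2, K < mdist xy.1 xy.2,
        K < mdist x0 xy.1 & K < mdist x0 xy.2].
  by move=> K; have [x [y h]] := hP K; exists (x, y).
(* Each threshold exceeds the previous one by 1 plus the distances from [x0] to the pair just
   chosen. A later pair is thus so far out that the triangle inequality through [x0] separates it
   from all earlier ones. *)
pose next K := K + 1 + mdist x0 (p K).1 + mdist x0 (p K).2.
pose K n := iter n next 0.
have KS n : K n.+1 = K n + 1 + mdist x0 (p (K n)).1 + mdist x0 (p (K n)).2.
  by [].
have Kn n : n%:R <= K n.
  elim: n => [//|n IH]; rewrite KS -natr1.
  have := mdist_ge0 x0 (p (K n)).1; have := mdist_ge0 x0 (p (K n)).2; lra.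
have Kmn m n : (m < n)%N -> n%:R + mdist x0 (p (K m)).1 <= K n /\
                            n%:R + mdist x0 (p (K m)).2 <= K n.
  elim: n => [//|n IH]; rewrite ltnS leq_eqVlt KS -natr1.
  have := mdist_ge0 x0 (p (K n)).1; have := mdist_ge0 x0 (p (K n)).2.
  have := Kn n => h0 h1 h2 /predU1P[->|/IH[h3 h4]]; first by split; lra.
  by split; lra.
exists (fun n => (p (K n)).1), (fun n => (p (K n)).2).
split=> [n|n|n|m n]; have [h1 h2 h3 h4] := hp (K n) => //.
- exact: le_lt_trans (Kn n) h3.
- exact: le_lt_trans (Kn n) h4.
have [mn|nm|->] := ltngtP m n; last exact: le_lt_trans (Kn n) h2.
  have [h _] := Kmn _ _ mn.
  have := metric_triangle x0 (p (K m)).1 (p (K n)).2.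
  have : m%:R <= n%:R :> R by rewrite ler_nat ltnW.
  lra.
have [_ h] := Kmn _ _ nm; have [_ _ h5 _] := hp (K m).
have := metric_triangle x0 (p (K n)).2 (p (K m)).1.
rewrite (metric_sym (p (K n)).2); lra.
Qed.

End divergent_sequences.

Section coarse_equivalence.
Context {R : realType}.
Implicit Types X Y : metricType R.

Lemma coarse_surjective X Y (f : X -> Y) (cf : coarse f) (x0 : X) :
  (forall d, exists c, corona_map cf c = d) ->
  exists M, forall y, exists x, mdist (f x) y <= M.
Proof.
move=> fsurj; apply: contrapT => /forallNP nM.
have /choice[y hy] : forall n : nat, exists y, forall x, n%:R < mdist (f x) y.
  move=> n; have /existsNP[y /forallNP hy] := nM n%:R.
  by exists y => x; rewrite ltNge; apply/negP/hy.
have dy : divergent y by apply: (@divergent_dist _ _ (f x0)) => n.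
have [U [UU Uoo]] := @ultraFilterLemma _ \oo _.
have [c] := fsurj (corona_class (seq_ultrafilter Uoo dy)).
rewrite -(corona_classK c) corona_mapE => /corona_classE/alike_sym w.
suff : ~ cwedge (range y) (range f).
  apply; apply: w; first exact: seq_ultrafilter_range.
  (* Membership of [range f] in the pushforward means membership of its preimage, which is the whole
     space. *)
  apply: (eq_ind setT (repr c)); first exact: ultra_setT.
  by apply/seteqP; split=> // x _; exists x.
apply: cwedgeN_range => r; near=> n => _ [x _ <-].
rewrite metric_sym (le_lt_trans _ (hy n x))//.
by near: n; exact: nbhs_infty_ger.
Unshelve. all: by end_near. Qed.

(** If one point of a pair is within [K] of [x0], both images lie in the ball of radius [M + r]
    about [f x0]. Its preimage is bounded, of radius [L] about [x0], so the pair is at distance at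
    most [L + L]. *)
Lemma coarse_unbounded_pairs X Y (f : X -> Y) (cf : coarse f) (x0 : X) (r : R) :
  (forall K, exists x y, mdist (f x) (f y) <= r /\ K < mdist x y) ->
  forall K, exists x y, [/\ mdist (f x) (f y) <= r, K < mdist x y,
                            K < mdist x0 x & K < mdist x0 y].
Proof.
move=> hK K; have [M hM] := coarse_modulus cf K.
have /mboundedP/(_ x0)[L hL] :
    mbounded (f @^-1` [set y | mdist (f x0) y <= M + r]).
  by apply: cf.2; apply/coarse_entourageP; exists (M + r + (M + r)) => y z [/=];
     have := metric_triangle y (f x0) z; rewrite (metric_sym y (f x0)); lra.
have [x [y [fxy xy]]] := hK (Num.max K (L + L)).
move: xy; rewrite gt_max => /andP[Kxy Lxy]; exists x, y.
have r0 : 0 <= r := le_trans (mdist_ge0 _ _) fxy.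
have far : mdist (f x0) (f x) <= M + r -> mdist (f x0) (f y) <= M + r -> False.
  move=> /hL hx /hL hy; have := metric_triangle x x0 y.
  by rewrite (metric_sym x x0); lra.
split=> //; rewrite ltNge; apply/negP => /hM h; apply: far; try lra.
  by have := metric_triangle (f x0) (f x) (f y); lra.
have := metric_triangle (f x0) (f y) (f x).
by rewrite (metric_sym (f y)); lra.
Qed.

Lemma coarse_embedding X Y (f : X -> Y) (cf : coarse f) (x0 : X) :
  injective (corona_map cf) ->
  forall r, exists M, forall x y, mdist (f x) (f y) <= r -> mdist x y <= M.
Proof.
move=> finj r; apply: contrapT => /forallNP nM.
have hK K : exists x y, mdist (f x) (f y) <= r /\ K < mdist x y.
  have /existsNP[x /existsNP[y /not_implyP[fxy xy]]] := nM K.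
  by exists x, y; split=> //; rewrite ltNge; exact/negP.
have [x [y [fxy hx hy hxy]]] := sparse_pairs (coarse_unbounded_pairs cf x0 hK).
have dx := divergent_dist hx; have dy := divergent_dist hy.
have [U [UU Uoo]] := @ultraFilterLemma _ \oo _.
have : corona_class (seq_ultrafilter Uoo dx) =
       corona_class (seq_ultrafilter Uoo dy).
  by apply: finj; rewrite !corona_mapE; apply/corona_classE/alike_push_seq.
move=> /corona_classE /(_ _ _ (seq_ultrafilter_range Uoo dx)
                              (seq_ultrafilter_range Uoo dy)).
apply: cwedgeN_range => s; near=> n => _ [m _ <-].
rewrite (le_lt_trans _ (hxy n m))//.
by near: n; exact: nbhs_infty_ger.
Unshelve. all: by end_near. Qed.

(** The inverse [g] chooses approximate preimages. The embedding condition on [f] makes [g] preserve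
    entourages; the modulus of [f] makes preimages of bounded sets under [g] bounded. *)
Lemma coarse_inverse X Y (f : X -> Y) : coarse f ->
  (exists M, forall y, exists x, mdist (f x) y <= M) ->
  (forall r, exists M, forall x y, mdist (f x) (f y) <= r -> mdist x y <= M) ->
  exists g : Y -> X,
    [/\ coarse g, coarse_close (g \o f) idfun & coarse_close (f \o g) idfun].
Proof.
move=> cf [M /choice[g hg]] femb; exists g; split; last 2 first.
- have [s hs] := femb M; apply/coarse_closeP; exists s => x /=.
  exact: hs.
- by apply/coarse_closeP; exists M.
split=> [E /coarse_entourageP[r hr]|B /coarse_entourageP[r hr]].
  (* Moving from [f (g y)] to [y], [z] and [f (g z)] costs at most [M], [r] and [M]. *)
  have [s hs] := femb (M + r + M).
  apply/coarse_entourageP; exists s => _ _ [[y z] /hr yz [<- <-]] /=.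
  apply: hs; have := metric_triangle (f (g y)) y (f (g z)).
  have := metric_triangle y z (f (g z)); have := hg y; have := hg z.
  by rewrite (metric_sym (f (g z))); lra.
have [s hs] := coarse_modulus cf r.
apply/coarse_entourageP; exists (M + s + M) => y z [/= By Bz].
have := hs _ _ (hr _ _ (conj By Bz)).
have := metric_triangle y (f (g y)) z; have := hg y; have := hg z.
have := metric_triangle (f (g y)) (f (g z)) z.
by rewrite (metric_sym y (f (g y))); lra.
Qed.

End coarse_equivalence.

Theorem corollary17 (R : realType) : reflects_isomorphisms (nu R).
Proof.
move=> X Y u [v [vu uv]].
have [x0 _] := nemetric_nonempty X.
pose cf := coarse_funP (repr u).
(* Read pointwise, the two identities in [Top] give injectivity and surjectivity of the corona map
   of a representative of [u]. *)
have vuK c : v (corona_map cf c) = c :=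
  f_equal (fun h : continuousType (corona X) (corona X) => h c) vu.
have uvK d : corona_map cf (v d) = d :=
  f_equal (fun h : continuousType (corona Y) (corona Y) => h d) uv.
have fsurj := coarse_surjective x0 (fun d => ex_intro _ (v d) (uvK d)).
have femb := coarse_embedding x0 (can_inj vuK).
have [g [cg gf fg]] := coarse_inverse cf fsurj femb.
exists (coarse_class (CoarseMap cg)); rewrite -(coarse_classK u) /=.
by split; rewrite coarse_mor_compE; exact/coarse_classE.
Qed.
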